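(* Let $f\in C_B[0,\infty)$. Let $(a_0(n))$ and $(a_1(n))$ be convergent real sequences satisfying $2a_0(n)-a_1(n)=1$ for all $n$, and suppose that the associated operators $V_{n,1}$ are positive. Then, for every compact subset $A\subset[0,\infty)$, $V_{n,1}(f;x)$ converges to $f(x)$ uniformly on $A$ as $n\to\infty$.
   Context: For integers $n\ge 1$, $k\ge 0$ and $x\in[0,\infty)$ let $p_{n,k}(x)=\binom{n+k-1}{k}\frac{x^k}{(1+x)^{n+k}}$, and set $p_{n,k}=0$ for $k<0$. $C_B[0,\infty)$ denotes the space of bounded continuous real-valued functions on $[0,\infty)$. Given real sequences $a_0(n),a_1(n)$, put $a(x,n)=a_0(n)+a_1(n)x$ and $b(x,n)=a_0(n)-a_1(n)(1+x)$, and $$p^1_{n,k}(x)=a(x,n)\,p_{n+1,k}(x)+b(x,n)\,p_{n+1,k-1}(x).$$ For $n\ge 2$ the first order modification of the Baskakov-Durrmeyer operators is $$V_{n,1}(f;x)=(n-1)\sum_{k=0}^{\infty}p^1_{n,k}(x)\int_0^{\infty}p_{n,k}(t)f(t)\,dt,\qquad x\in[0,\infty).$$ The operators are called positive if $f\ge 0$ on $[0,\infty)$ implies $V_{n,1}(f;x)\ge 0$ for all $x\in[0,\infty)$ (for every $n$). *)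

(* Defs.v *)
From HB Require Import structures.
From mathcomp Require Import all_boot all_order all_algebra.
From mathcomp Require Import all_classical all_reals all_analysis.

Set Implicit Arguments.
Unset Strict Implicit.
Unset Printing Implicit Defensive.

Import Order.TTheory GRing.Theory Num.Theory.
Import numFieldNormedType.Exports.

Local Open Scope classical_set_scope.
Local Open Scope ring_scope.

(* Functions on [0, +oo) are represented by total functions R -> R of which only
   the values on [0, +oo) are ever used. *)
Definition CB (R : realType) (f : R -> R) : Prop :=
  {within `[0, +oo[, continuous f} /\ [bounded f x | x in `[0, +oo[].

(* The index k is an integer so that the terms p_{n,k-1} make sense at k = 0.
   The natural-number subtraction in the binomial coefficient is exact because
   n >= 1 in all uses. *)
Definition baskakov (R : realType) (n : nat) (k : int) (x : R) : R :=
  match k with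
  | Posz j => 'C(n + j - 1, j)%:R * (x ^+ j / (1 + x) ^+ (n + j))
  | Negz _ => 0
  end.

Definition acoef (R : realType) (a0 a1 : R^nat) (x : R) (n : nat) : R :=
  a0 n + a1 n * x.

Definition bcoef (R : realType) (a0 a1 : R^nat) (x : R) (n : nat) : R :=
  a0 n - a1 n * (1 + x).

Definition baskakov1 (R : realType) (a0 a1 : R^nat) (n : nat) (k : int) (x : R)
    : R :=
  acoef a0 a1 x n * baskakov n.+1 k x + bcoef a0 a1 x n * baskakov n.+1 (k - 1) x.

(* Real-valued Lebesgue integral and limit of partial sums: for n >= 2, x >= 0 and
   f in CB, every integral is absolutely convergent and so is the series. *)
Definition V1 (R : realType) (a0 a1 : R^nat) (n : nat) (f : R -> R) (x : R) : R :=
  (n%:R - 1) *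
  limn (series (fun k : nat =>
    baskakov1 a0 a1 n k%:Z x *
    \int[@lebesgue_measure R]_(t in `[0, +oo[) (baskakov n k%:Z t * f t))).

Definition V1_positive (R : realType) (a0 a1 : R^nat) : Prop :=
  forall n : nat, (2 <= n)%N ->
  forall f : R -> R, CB f -> (forall t, 0 <= t -> 0 <= f t) ->
  forall x, 0 <= x -> 0 <= V1 a0 a1 n f x.

(* Main.v *)
Require Import Defs.
From HB Require Import structures.
From mathcomp Require Import all_boot all_order all_algebra.
From mathcomp Require Import all_classical all_reals all_analysis.
From mathcomp Require Import measurable_realfun.
From mathcomp Require Import zify ring lra.
Import Order.TTheory GRing.Theory Num.Theory.
Import numFieldNormedType.Exports.
Local Open Scope classical_set_scope.
Local Open Scope ring_scope.

(** The operator averages [f] twice: against the densities [(n - 1) p_{n,k}] on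
    the half-line, and then over [k] with weights [p^1_{n,k}(x)], whose sum is
    [a + b = 2 a0 - a1 = 1].  Hence [V f x - f x] is the same double average of
    [f t - f x], and
      [|p^1_{n,k}| <= |a| p_{n+1,k} + |b| p_{n+1,k-1}]
    with [|a| + |b|] bounded uniformly in [n] and in [x] on a bounded set, so
    that it is enough to control averages against nonnegative weights.

    On a compact set a bounded continuous [f] satisfies, for every [e > 0], an
    inequality [|f t - f x| <= e + C (t - x)^2] ([le_quadratic_modulus]), and
    the double average of [(t - x)^2] is explicit and [O(1/n)].  Two facts give
    it.  The partial sums of the basis telescope under differentiation,
    [(\sum_(i <= k) p_{N,i})' = - N p_{N+1,k}], which yields
    [\int p_{N+1,k} = 1/N] ([integral_baskakov]).  The identity
    [(k + 1) p_{N,k+1}(x) = N x p_{N+1,k}(x)] ([mulr_baskakovS]) turns a factor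
    [x] under the integral, or a factor [k] in the series, into a change of
    indices, so that all second moments reduce to [\int p_{N+1,k} = 1/N] and
    to [\sum_k p_{N,k}(x) = 1] ([cvg_sum_baskakov]).  The quantitative
    conclusion is [V1_dist_le]. *)

Set Implicit Arguments.
Unset Strict Implicit.
Unset Printing Implicit Defensive.

(** * Convergent series *)

Section Series.
Context {R : realType}.

Lemma cvg_series_behead (u v : R^nat) (l : R) :
  u 0%N = 0 -> (forall k, u k.+1 = v k) ->
  series v @ \oo --> l -> series u @ \oo --> l.
Proof.
move=> u0 uS vl; rewrite -cvg_shiftS.
rewrite (_ : (fun _ => _) = series v)//; apply/funext => K.
rewrite /series/= big_nat_recl// u0 add0r; exact: eq_bigr.
Qed.

Lemma cvg_seriesMl (c : R) (u : R^nat) (l : R) :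
  series u @ \oo --> l -> series (fun k => c * u k) @ \oo --> c * l.
Proof.
move=> ul; rewrite (_ : series _ = (fun K => c * series u K)); first exact: cvgMr.
by apply/funext => K; rewrite /series/= mulr_sumr.
Qed.

Lemma cvg_series_add (u v : R^nat) (l m : R) :
  series u @ \oo --> l -> series v @ \oo --> m ->
  series (fun k => u k + v k) @ \oo --> l + m.
Proof.
move=> ul vm; rewrite (_ : series _ = series u \+ series v); first exact: cvgD.
by apply/funext => K; rewrite /series/= big_split.
Qed.

(** Subtracting [y] termwise costs nothing since the weights [c k] sum to 1, and
    the differences converge absolutely; [c] itself may change sign. *)
Lemma cvg_series_dist (c J G : R^nat) (y L : R) :
  (forall k, `|c k * (J k - y)| <= G k) ->
  series G @ \oo --> L -> series c @ \oo --> (1 : R) ->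
  exists2 l, series (fun k => c k * J k) @ \oo --> l & `|l - y| <= L.
Proof.
move=> cG GL c1; pose d k := c k * (J k - y).
have G0 k : 0 <= G k by exact: le_trans (cG k).
have cvgG : cvgn (series G) by apply/cvg_ex; exists L.
have nd : cvgn [normed series d] by apply: series_le_cvg cvgG => //= k.
have cd := normed_cvg nd.
exists (limn (series d) + y).
  have -> : (fun k => c k * J k) = (fun k => d k + y * c k).
    by apply/funext => k; rewrite /d; ring.
  have := cvg_series_add cd (@cvg_seriesMl y _ _ c1).
  by rewrite mulr1.
rewrite addrK (le_trans (lim_series_norm nd))// -(cvg_lim _ GL)//.
exact: lim_series_le.
Qed.

End Series.

(** * The Baskakov basis as a negative binomial distribution *)

Section BaskakovBasis.
Context {R : realType}.
Implicit Types (n N k K : nat) (x t : R).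

Lemma baskakov_ge0 n (k : int) x : 0 <= x -> 0 <= baskakov n k x.
Proof.
by case: k => //= k x0; rewrite mulr_ge0 ?divr_ge0 ?exprn_ge0 ?addr_ge0.
Qed.

Lemma baskakov_predS n k x : baskakov n (k.+1%:Z - 1) x = baskakov n k%:Z x.
Proof. by congr baskakov; lia. Qed.

(** Both moments below and the integrals of [t * p_{n,k}(t)] come from this
    identity: a factor [k] or [x] is absorbed by shifting the two indices. *)
Lemma mulr_baskakovS N k x :
  k.+1%:R * baskakov N k.+1%:Z x = N%:R * x * baskakov N.+1 k%:Z x.
Proof.
rewrite /= addnS addSn !subn1 /=.
have : k.+1%:R * 'C(N + k, k.+1)%:R = N%:R * 'C(N + k, k)%:R :> R.
  by rewrite -!natrM mul_bin_left addnK.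
rewrite exprS; move: ('C(_, _)%:R) ('C(_, _)%:R) (_^-1) => A B C AB.
by rewrite mulrA AB; ring.
Qed.

Lemma baskakov_pascal N k x : 1 + x != 0 ->
  (1 + x) * baskakov N.+1 k.+1%:Z x =
  baskakov N k.+1%:Z x + x * baskakov N.+1 k%:Z x.
Proof.
move=> x0; rewrite /= !addnS !addSn !subn1 /= binS natrD !exprS.
by field; rewrite expf_neq0 ?x0.
Qed.

(** Summing Pascal's rule over [k] makes everything cancel but the last term.
    Induction on [N] then sums the negative binomial series. *)
Lemma sum_baskakovS N K x : 1 + x != 0 ->
  \sum_(k < K.+1) baskakov N.+1 k%:Z x =
  \sum_(k < K.+1) baskakov N k%:Z x - x * baskakov N.+1 K%:Z x.
Proof.
move=> x0; elim: K => [|K IH].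
  rewrite !big_ord_recl !big_ord0 /= !addn0 subn1 /= !bin0 expr0 exprS.
  by field; rewrite expf_neq0 ?x0.
rewrite big_ord_recr/= IH [in RHS]big_ord_recr/=.
by have := baskakov_pascal N K x0; rewrite /=; nra.
Qed.

(** At [N = 0] the truncated subtraction makes [p_{0,0} = 1] and [p_{0,k} = 0]
    for [k > 0], a convenient base case for the induction. *)
Lemma sum_baskakov0 K x : \sum_(k < K.+1) baskakov 0 k%:Z x = 1.
Proof.
rewrite big_ord_recl /= bin0 expr0 divr1 mulr1 big1 ?addr0// => i _.
by rewrite /bump /= add0n add1n subn1 /= bin_small// mul0r.
Qed.

Lemma sum_baskakov_le1 N K x : 0 <= x -> \sum_(k < K.+1) baskakov N k%:Z x <= 1.
Proof.
move=> x0; elim: N => [|N IH]; first by rewrite sum_baskakov0.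
rewrite sum_baskakovS ?gt_eqF ?ltr_pwDl//.
by rewrite (le_trans _ IH)// gerBl mulr_ge0// baskakov_ge0.
Qed.

Lemma cvg_baskakov0 N x : 0 <= x -> baskakov N k%:Z x @[k --> \oo] --> 0.
Proof.
move=> x0; apply: (@cvg_series_cvg_0 _ R^o); apply: nondecreasing_is_cvgn.
  by apply: nondecreasing_series => i _ _; exact: baskakov_ge0.
exists 1 => _ [[|K] _ <-]; rewrite /series/=; first by rewrite big_geq.
by rewrite big_mkord sum_baskakov_le1.
Qed.

(** The correction [x * p_{N+1,K}] in [sum_baskakovS] tends to 0, since it is the
    general term of a nonnegative series with bounded partial sums. *)
Lemma cvg_sum_baskakov N x : 0 <= x ->
  series (fun k => baskakov N k%:Z x) @ \oo --> (1 : R).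
Proof.
move=> x0; rewrite -cvg_shiftS; elim: N => [|N IH].
  apply: cvg_near_cst; apply: nearW => K.
  by rewrite /series/= big_mkord sum_baskakov0.
have -> : [sequence series (fun k => baskakov N.+1 k%:Z x) K.+1]_K =
  (fun K => series (fun k => baskakov N k%:Z x) K.+1 - x * baskakov N.+1 K%:Z x).
  apply/funext => K.
  by rewrite /series/= !big_mkord sum_baskakovS// gt_eqF// ltr_pwDl.
rewrite (_ : 1%R = 1 - x * 0); last by rewrite mulr0 subr0.
by apply: cvgB => //; apply: cvgMr; exact: cvg_baskakov0.
Qed.

(** The polynomials [1], [k], [k (k - 1)] are the basis in which each moment is
    one application of [mulr_baskakovS]. *)
Lemma cvg_sum_baskakov_quadratic N (c0 c1 c2 : R) x : 0 <= x ->
  series (fun k => baskakov N k%:Z x *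
    (c0 + c1 * k%:R + c2 * (k%:R * (k%:R - 1)))) @ \oo -->
  c0 + c1 * (N%:R * x) + c2 * (N%:R * N.+1%:R * x ^+ 2).
Proof.
move=> x0.
have m1 M : series (fun k => k%:R * baskakov M k%:Z x) @ \oo --> M%:R * x.
  apply: (@cvg_series_behead _ _ (fun k => M%:R * x * baskakov M.+1 k%:Z x)).
  - by rewrite mul0r.
  - by move=> k; rewrite mulr_baskakovS.
  have := @cvg_seriesMl _ (M%:R * x) _ _ (@cvg_sum_baskakov M.+1 x x0).
  by rewrite mulr1.
have m2 : series (fun k => k%:R * (k%:R - 1) * baskakov N k%:Z x) @ \oo -->
    N%:R * x * (N.+1%:R * x).
  apply: (@cvg_series_behead _ _
    (fun k => N%:R * x * (k%:R * baskakov N.+1 k%:Z x))).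
  - by rewrite !mul0r.
  - move=> k; rewrite (_ : k.+1%:R - 1 = k%:R); last by rewrite -natr1 addrK.
    by rewrite mulrAC mulr_baskakovS; ring.
  exact: cvg_seriesMl.
have := cvg_series_add (cvg_series_add
  (@cvg_seriesMl _ c0 _ _ (cvg_sum_baskakov N x0)) (@cvg_seriesMl _ c1 _ _ (m1 N)))
  (@cvg_seriesMl _ c2 _ _ m2).
rewrite mulr1 (_ : N%:R * N.+1%:R * x ^+ 2 = N%:R * x * (N.+1%:R * x)); last by ring.
have -> // : (fun k => baskakov N k%:Z x *
    (c0 + c1 * k%:R + c2 * (k%:R * (k%:R - 1)))) =
  (fun k => c0 * baskakov N k%:Z x + c1 * (k%:R * baskakov N k%:Z x) +
    c2 * (k%:R * (k%:R - 1) * baskakov N k%:Z x)).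
by apply/funext => k; ring.
Qed.
End BaskakovBasis.

(** * Integrals of the Baskakov basis *)

Section BaskakovIntegral.
Context {R : realType}.
Notation mu := (@lebesgue_measure R).
Implicit Types (n N k : nat) (x t : R).

Lemma is_derive_baskakov N k t : 0 <= t ->
  is_derive t (1 : R) (baskakov N k%:Z)
    (N%:R * (baskakov N.+1 (k%:Z - 1) t - baskakov N.+1 k%:Z t)).
Proof.
move=> t0; have t1 : 1 + t != 0 by rewrite gt_eqF// ltr_pwDl.
have d1 : is_derive t (1 : R) (fun s : R => 1 + s) 1.
  by have := is_deriveD (is_derive_cst (1 : R) t (1 : R)) (is_derive_id t (1 : R));
    rewrite add0r.
have d2 : is_derive t (1 : R) (fun s : R => (1 + s) ^+ (N + k))
    ((N + k)%:R * (1 + t) ^+ (N + k).-1).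
  by have := is_deriveX (N + k) d1; rewrite fctE /GRing.scale/= mulr1.
have d3 : is_derive t (1 : R) (fun s : R => s ^+ k) (k%:R * t ^+ k.-1).
  by have := is_deriveX k (is_derive_id t (1 : R)); rewrite fctE /GRing.scale/= mulr1.
have d4 := is_deriveV (f := fun s : R => (1 + s) ^+ (N + k)) (expf_neq0 (N + k) t1) d2.
have d5 := is_deriveM d3 d4.
have d6 := is_deriveZ 'C(N + k - 1, k)%:R d5.
apply: is_derive_eq d6 _.
rewrite /GRing.scale/=.
case: k {d2 d3 d4 d5} => [|k].
  rewrite (_ : baskakov N.+1 (0%:Z - 1) t = 0)//.
  case: N => [|N]; first by rewrite !mul0r !mulr0 addr0 mulr0.
  rewrite !bin0 !addn0 /= expr0 !exprS; field.
  by rewrite expf_neq0// t1.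
rewrite baskakov_predS /= !addnS !addSn !subn1 /= binS natrD.
have : k.+1%:R * 'C(N + k, k.+1)%:R = N%:R * 'C(N + k, k)%:R :> R.
  by rewrite -!natrM mul_bin_left addnK.
move: ('C(N + k, k.+1)%:R) ('C(N + k, k)%:R) => A B AB.
apply/eqP; rewrite -subr_eq0; apply/eqP.
(* The difference of the two sides is a multiple of the binomial identity [AB]. *)
transitivity ((k.+1%:R * A - N%:R * B) *
  (t ^+ k / (1 + t) ^+ (N + k).+1 - t ^+ k.+1 / (1 + t) ^+ (N + k).+2)).
  by rewrite -!natr1 natrD !exprS; field; rewrite expf_neq0 ?t1.
by rewrite AB subrr mul0r.
Qed.

(** The derivative of [p_{N,i}] is [N (p_{N+1,i-1} - p_{N+1,i})], so the sum
    telescopes; up to the factor [-1/N] this is a primitive of [p_{N+1,k}]. *)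
Lemma is_derive_sum_baskakov N k t : 0 <= t ->
  is_derive t (1 : R) (fun s : R => \sum_(i < k.+1) baskakov N i%:Z s)
    (- (N%:R * baskakov N.+1 k%:Z t)).
Proof.
move=> t0; elim: k => [|k IH].
  have -> : (fun s : R => \sum_(i < 1) baskakov N i%:Z s) = baskakov N 0%:Z.
    by apply/funext => s; rewrite big_ord1.
  apply: is_derive_eq (is_derive_baskakov N 0 t0) _.
  by rewrite (_ : baskakov N.+1 (0%:Z - 1) t = 0)// sub0r mulrN.
have -> : (fun s : R => \sum_(i < k.+2) baskakov N i%:Z s) =
    (fun s : R => \sum_(i < k.+1) baskakov N i%:Z s) + baskakov N k.+1%:Z.
  by apply/funext => s; rewrite big_ord_recr.
apply: is_derive_eq (is_deriveD IH (is_derive_baskakov N k.+1 t0)) _.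
by rewrite baskakov_predS; ring.
Qed.

Lemma baskakov_le_inv N k t : 0 <= t ->
  baskakov N.+1 k%:Z t <= 'C(N + k, k)%:R * (1 + t)^-1.
Proof.
move=> t0; rewrite /= addSn subn1 /= ler_wpM2l// exprS exprD.
rewrite ler_pdivrMr; last by rewrite -exprD -exprS exprn_gt0// ltr_pwDl.
rewrite mulKf ?gt_eqF ?ltr_pwDl//.
rewrite -[X in X <= _]mul1r ler_pM ?exprn_ge0 ?exprn_ege1 ?lerDl//.
by rewrite lerXn2r ?nnegrE ?addr_ge0// lerDr.
Qed.

Lemma baskakov_cvgy N k : baskakov N.+1 k%:Z t @[t --> +oo] --> (0 : R).
Proof.
apply: (@squeeze_cvgr _ _ _ _ (fun=> 0) (fun t => 'C(N + k, k)%:R * (1 + t)^-1)).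
- near=> t; rewrite baskakov_ge0 ?baskakov_le_inv//.
- exact: cvg_cst.
- rewrite -(mulr0 'C(N + k, k)%:R); apply: cvgMr.
  apply/gtr0_cvgV0; first by near=> t; rewrite ltr_pwDl.
  exact: cvg_addrl.
Unshelve. all: by end_near. Qed.

Lemma continuous_baskakov n k t : 0 <= t ->
  {for t, continuous (baskakov n k%:Z : R -> R)}.
Proof.
move=> t0; have /@ex_derive := is_derive_baskakov n k t0.
by move=> /derivable1_diffP /differentiable_continuous.
Qed.

Lemma within_continuous_baskakov n k :
  {within `[0, +oo[, continuous (baskakov n k%:Z : R -> R)}.
Proof.
apply: continuous_in_subspaceT => t; rewrite inE/= in_itv/= andbT.
exact: continuous_baskakov.
Qed.

(** The primitive of [is_derive_sum_baskakov] vanishes at infinity, and at 0 only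
    its term [p_{N,0}(0) = 1] survives. *)
Lemma integral_baskakov N k : (0 < N)%N ->
  (\int[mu]_(t in `[0%R, +oo[) (baskakov N.+1 k%:Z t)%:E = (N%:R^-1)%:E)%E.
Proof.
case: N => // N _.
pose F t : R := - (N.+1%:R^-1) * \sum_(i < k.+1) baskakov N.+1 i%:Z t.
have dF t : 0 <= t -> is_derive t (1 : R) F (baskakov N.+2 k%:Z t).
  move=> t0; have d := is_derive_sum_baskakov N.+1 k t0.
  apply: is_derive_eq (is_deriveZ (- (N.+1%:R^-1)) d) _.
  by rewrite /GRing.scale/= mulrNN mulKf// pnatr_eq0.
rewrite (@ge0_continuous_FTC2y _ _ F _ 0).
- rewrite /F big_ord_recl big1 /= => [|i _]; last first.
    by rewrite /bump/= add1n expr0n /= mul0r mulr0.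
  by rewrite bin0 expr0 !addr0 expr1n divr1 !mulr1 -EFinB sub0r opprK.
- by move=> t t0; exact: baskakov_ge0.
- exact: within_continuous_baskakov.
- rewrite -(mulr0 (- (N.+1%:R^-1))); apply: cvgMr.
  have := @cvg_big R 'I_k.+1 +%R 0 xpredT
    (@pseudometric_normed_Zmodule.add_continuous _ R^o)
    R +oo (index_enum _) (fun i t => baskakov N.+1 i%:Z t) (fun=> 0) _
    (fun i _ => baskakov_cvgy N i).
  by rewrite big1//; apply.
- by move=> t t0; exact: (@ex_derive _ _ _ _ _ _ _ (dF t (ltW t0))).
- apply: cvg_at_right_filter.
  have /@ex_derive := dF 0 (lexx _).
  by move=> /derivable1_diffP /differentiable_continuous.
- move=> t; rewrite in_itv/= andbT => t0.
  by rewrite derive1E; exact: (@derive_val _ _ _ _ _ _ _ (dF t (ltW t0))).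
Qed.

Lemma integrable_baskakov N k : (0 < N)%N ->
  mu.-integrable `[0, +oo[ (EFin \o baskakov N.+1 k%:Z).
Proof.
move=> N0; apply/integrableP; split.
  apply/measurable_EFinP.
  exact: subspace_continuous_measurable_fun (@within_continuous_baskakov N.+1 k).
apply: le_lt_trans (ltry N%:R^-1); rewrite -(integral_baskakov k N0).
rewrite le_eqVlt; apply/orP; left; apply/eqP; apply: eq_integral => t.
rewrite inE => t0; transitivity (`|baskakov N.+1 k%:Z t|%:E) => //.
by rewrite ger0_norm//; apply: baskakov_ge0; move: t0; rewrite /= in_itv/= andbT.
Qed.

Lemma Rintegral_baskakov N k : (0 < N)%N ->
  \int[mu]_(t in `[0, +oo[) baskakov N.+1 k%:Z t = N%:R^-1.
Proof. by move=> N0; rewrite /Rintegral integral_baskakov. Qed.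

(** Two applications of [mulr_baskakovS]: the factors [t] and [t^2] lower [n] by
    1 and 2.  Writing [n = m + 4] keeps the last basis function, of order
    [m + 2], integrable. *)
Lemma baskakov_quadraticE m k (c0 c1 c2 : R) t :
  baskakov m.+4 k%:Z t * (c0 + c1 * t + c2 * t ^+ 2) =
  c0 * baskakov m.+4 k%:Z t +
  c1 * (k.+1%:R / m.+3%:R) * baskakov m.+3 k.+1%:Z t +
  c2 * (k.+1%:R * k.+2%:R / (m.+3%:R * m.+2%:R)) * baskakov m.+2 k.+2%:Z t.
Proof.
have e1 := mulr_baskakovS m.+3 k t.
have e2 := mulr_baskakovS m.+2 k.+1 t.
have m3 : m.+3%:R != 0 :> R by rewrite pnatr_eq0.
have m2 : m.+2%:R != 0 :> R by rewrite pnatr_eq0.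
have k2 : k.+2%:R != 0 :> R by rewrite pnatr_eq0.
have {e2} e2 : baskakov m.+2 k.+2%:Z t =
    m.+2%:R * t * baskakov m.+3 k.+1%:Z t / k.+2%:R.
  by rewrite -e2 [RHS]mulrC mulKf.
have {e1} e1 : t * baskakov m.+4 k%:Z t =
    k.+1%:R * baskakov m.+3 k.+1%:Z t / m.+3%:R.
  by rewrite e1 [RHS]mulrC -(mulrA m.+3%:R) mulKf.
rewrite e2 [LHS](_ : _ = c0 * baskakov m.+4 k%:Z t +
  (c1 + c2 * t) * (t * baskakov m.+4 k%:Z t)); last by ring.
rewrite e1; move: (baskakov _ _ _) (baskakov _ _ _) => u v.
move: m.+2%:R m.+3%:R k.+1%:R k.+2%:R m2 m3 k2 => A B K1 K2 A0 B0 K20.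
by field; rewrite A0 B0 K20.
Qed.

Lemma integrable_baskakov_quadratic m k (c0 c1 c2 : R) :
  mu.-integrable `[0, +oo[
    (EFin \o (fun t => baskakov m.+4 k%:Z t * (c0 + c1 * t + c2 * t ^+ 2))).
Proof.
rewrite (_ : _ \o _ = (fun t => (c0%:E * (EFin \o baskakov m.+4 k%:Z) t +
  (c1 * (k.+1%:R / m.+3%:R))%:E * (EFin \o baskakov m.+3 k.+1%:Z) t +
  (c2 * (k.+1%:R * k.+2%:R / (m.+3%:R * m.+2%:R)))%:E *
     (EFin \o baskakov m.+2 k.+2%:Z) t)%E)).
  by apply: integrableD => //; [apply: integrableD => //|];
    apply: integrableZl => //; exact: integrable_baskakov.
by apply/funext => t; rewrite [LHS]/comp baskakov_quadraticE !EFinD !EFinM.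
Qed.

Lemma Rintegral_baskakov_quadratic m k (c0 c1 c2 : R) :
  \int[mu]_(t in `[0, +oo[)
    (baskakov m.+4 k%:Z t * (c0 + c1 * t + c2 * t ^+ 2)) =
  m.+3%:R^-1 * (c0 + c1 * (k.+1%:R / m.+2%:R) +
    c2 * (k.+1%:R * k.+2%:R / (m.+2%:R * m.+1%:R))).
Proof.
have iZ (c : R) N i : (0 < N)%N ->
    mu.-integrable `[0, +oo[ (EFin \o (fun t => c * baskakov N.+1 i%:Z t)).
  move=> N0; rewrite (_ : _ \o _ =
    (fun t => (c%:E * (EFin \o baskakov N.+1 i%:Z) t)%E))//.
  by apply: integrableZl => //; exact: integrable_baskakov.
have vZ (c : R) N i : (0 < N)%N ->
    \int[mu]_(t in `[0, +oo[) (c * baskakov N.+1 i%:Z t) = c / N%:R.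
  move=> N0; rewrite -(Rintegral_baskakov i N0); apply: RintegralZl => //.
  exact: integrable_baskakov.
under eq_Rintegral do rewrite baskakov_quadraticE.
rewrite RintegralD//; [|exact: (integrableD _ (iZ _ _ _ _) (iZ _ _ _ _))|exact: iZ].
rewrite RintegralD//; [|exact: iZ|exact: iZ].
rewrite !vZ//.
have := (pnatr_eq0 R m.+1, pnatr_eq0 R m.+2, pnatr_eq0 R m.+3).
move: m.+1%:R m.+2%:R m.+3%:R k.+1%:R k.+2%:R => A B C K1 K2 ABC.
by field; rewrite !ABC.
Qed.
End BaskakovIntegral.

(** * Distance from the operator to the identity *)

Section Estimates.
Context {R : realType}.
Notation mu := (@lebesgue_measure R).

(** Uniform continuity at the points of the compact set [A] only: [t] ranges over
    all of [D], so Heine's theorem on [A] itself would not be enough. *)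
Lemma within_continuous_modulus (D A : set R) (f : R -> R) :
  {within D, continuous f} -> compact A -> A `<=` D ->
  forall e : R, 0 < e -> exists2 d, 0 < d &
    forall x t, A x -> D t -> `|t - x| < d -> `|f t - f x| <= e.
Proof.
move=> cf /compact_near_coveringP cA AD e e0.
pose P (d x : R) := D x -> forall t, D t -> `|t - x| < d -> `|f t - f x| <= e.
have /cA : forall x, A x -> \forall x' \near x & d \near 0^'+, P d x'.
  move=> x Ax; have Dx := AD _ Ax.
  have e2 : 0 < e / 2 by rewrite divr_gt0.
  have /cvgrPdist_lt/(_ _ e2) : f @ within D (nbhs x) --> f x.
    by have := cf x; rewrite /continuous_at /= nbhs_subspace_in.
  move=> /nbhs_ballP[/= r r0 rf].
  exists (ball x (r / 2), [set d | d < r / 2]) => [|[x' d] /= [xx' dr] Dx' t Dt tx'].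
    split=> /=; first by apply: nbhsx_ballx; rewrite divr_gt0.
    by apply: nbhs_right_lt; rewrite divr_gt0.
  have hx' : `|f x - f x'| < e / 2.
    by apply: rf => //; apply: le_ball xx'; lra.
  have ht : `|f x - f t| < e / 2.
    apply: rf => //; rewrite /ball/= in xx' *.
    rewrite (le_lt_trans (ler_distD x' _ _))// (distrC x'); lra.
  by rewrite (le_trans (ler_distD (f x) _ _))// (distrC (f t)); lra.
move=> near_d; near (0 : R)^'+ => d; exists d; first by near: d; exact: nbhs_right_gt.
move=> x t Ax Dt; have PA : A `<=` P d by near: d; exact: near_d.
by apply: PA => //; exact: AD.
Unshelve. all: by end_near. Qed.

(** Near [x] the oscillation of [f] is at most [e]; at distance at least [d], it
    is at most [2 M <= 2 M (t - x)^2 / d^2], with [M] a bound of [f]. *)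
Lemma le_quadratic_modulus (f : R -> R) (A : set R) :
  CB f -> compact A -> A `<=` `[0, +oo[ ->
  forall e : R, 0 < e -> exists2 C, 0 <= C & forall x t, A x -> 0 <= t ->
    `|f t - f x| <= e + C * (t - x) ^+ 2.
Proof.
move=> [cf [M0 [_ fM0]]] cA A0 e e0.
have [d d0 hd] := within_continuous_modulus cf cA A0 e0.
pose M := `|M0| + 1.
have fM t : 0 <= t -> `|f t| <= M.
  move=> t0; apply: (fM0 M); last by rewrite /= in_itv/= andbT.
  by rewrite (le_lt_trans (ler_norm _))// ltrDl.
have M_ge0 : 0 <= M by rewrite addr_ge0.
have d20 : 0 < d ^+ 2 by rewrite exprn_gt0.
have C_ge0 : 0 <= 2 * M / d ^+ 2 by rewrite divr_ge0 ?(ltW d20)// mulr_ge0.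
exists (2 * M / d ^+ 2) => //.
move=> x t Ax t0; have x0 : 0 <= x by have := A0 _ Ax; rewrite /= in_itv/= andbT.
have [td|td] := ltP `|t - x| d.
  rewrite (@le_trans _ _ e)//; first by apply: hd => //; rewrite /= in_itv/= t0.
  by rewrite lerDl mulr_ge0 ?sqr_ge0.
rewrite (@le_trans _ _ (2 * M))//.
  by rewrite (le_trans (ler_normB _ _))// mulr_natl mulr2n lerD ?fM.
rewrite ler_wpDl ?(ltW e0)// mulrAC ler_pdivlMr// ler_wpM2l ?mulr_ge0//.
by rewrite -(real_normK (num_real (t - x))) lerXn2r ?nnegrE// ltW.
Qed.

(** The average of [(t - x)^2] against the density [(n - 1) p_{n,k}], for
    [n = m + 4].  The index [k] is a real number so that a shift of it by 1 is
    an ordinary substitution. *)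
Definition mean_sq_dev (m : nat) (x k : R) : R :=
  x ^+ 2 - 2 * x * ((k + 1) / m.+2%:R) +
  (k + 1) * (k + 2) / (m.+2%:R * m.+1%:R).

(** [m.+3 * baskakov m.+4 k] is a density of total mass 1, so both [f x] and the
    bound on [|f t - f x|] can be averaged against it. *)
Lemma Rintegral_baskakov_dist (m k : nat) (f : R -> R) (x e C : R) :
  measurable_fun (`[0, +oo[%classic : set R) f ->
  (forall t, 0 <= t -> `|f t - f x| <= e + C * (t - x) ^+ 2) ->
  `|m.+3%:R * \int[mu]_(t in `[0, +oo[) (baskakov m.+4 k%:Z t * f t) - f x| <=
  e + C * mean_sq_dev m x k%:R.
Proof.
move=> mf hf; pose p : R -> R := baskakov m.+4 k%:Z.
have p0 t : `[0, +oo[%classic t -> 0 <= p t.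
  by rewrite /= in_itv/= andbT; exact: baskakov_ge0.
have mp : measurable_fun (`[0, +oo[%classic : set R) p.
  exact: subspace_continuous_measurable_fun (@within_continuous_baskakov _ m.+4 k).
have ip : mu.-integrable `[0, +oo[ (EFin \o p) by exact: integrable_baskakov.
(* [W t] is [e + C * (t - x) ^+ 2], expanded in powers of [t]. *)
pose W t := (e + C * x ^+ 2) + (- (2 * C * x)) * t + C * t ^+ 2.
have iW : mu.-integrable `[0, +oo[ (EFin \o (fun t => p t * W t)).
  exact: integrable_baskakov_quadratic.
have pW t : `[0, +oo[%classic t -> `|p t * (f t - f x)| <= p t * W t.
  move=> t0; rewrite normrM (ger0_norm (p0 _ t0)) ler_wpM2l ?p0//.
  rewrite (_ : W t = e + C * (t - x) ^+ 2); last by rewrite /W; ring.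
  by apply: hf; move: t0; rewrite /= in_itv/= andbT.
have id : mu.-integrable `[0, +oo[ (EFin \o (fun t => p t * (f t - f x))).
  apply: le_integrable iW => //.
    apply/measurable_EFinP; apply: measurable_funM => //.
    by apply: measurable_funB => //; exact: measurable_cst.
  move=> t t0 /=; rewrite lee_fin (le_trans (pW _ t0))//; exact: ler_norm.
have ifx : mu.-integrable `[0, +oo[ (EFin \o (fun t => f x * p t)).
  rewrite (_ : _ \o _ = (fun t => ((f x)%:E * (EFin \o p) t)%E))//.
  exact: integrableZl.
have -> : \int[mu]_(t in `[0, +oo[) (baskakov m.+4 k%:Z t * f t) =
    \int[mu]_(t in `[0, +oo[) (p t * (f t - f x)) + f x / m.+3%:R.
  rewrite -(@Rintegral_baskakov _ m.+3 k)// -[X in _ + X]RintegralZl//.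
  by rewrite -RintegralD//; apply: eq_Rintegral => t _; rewrite -/p; ring.
rewrite mulrDr (mulrCA _ (f x)) divff ?pnatr_eq0// mulr1 addrK.
rewrite normrM ger0_norm// mulrC -ler_pdivlMr ?ltr0n//.
rewrite (le_trans (le_normr_Rintegral _ id))//.
apply: (@le_trans _ _ (\int[mu]_(t in `[0, +oo[) (p t * W t))).
  apply: le_Rintegral => //.
  by have := integrable_norm id.
rewrite Rintegral_baskakov_quadratic mulrC ler_wpM2r ?invr_ge0//.
rewrite /mean_sq_dev -!natr1; lra.
Qed.

(** The shifts [s = 0] and [s = 1] are those of the two weights [p_{n+1,k}] and
    [p_{n+1,k-1}], for [n = m + 4].  The terms of order [m ^+ 2] cancel in the
    numerator of the limit, which is therefore [O(1/m)]. *)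
Lemma cvg_sum_mean_sq_dev (m : nat) (s e C x : R) : 0 <= x ->
  series (fun k => baskakov m.+4.+1 k%:Z x * (e + C * mean_sq_dev m x (k%:R + s)))
    @ \oo -->
  e + C * (((2 * m%:R + 22) * x ^+ 2 + (2 * m%:R + 18 + 8 * s) * x +
            (s + 1) * (s + 2)) / (m.+2%:R * m.+1%:R)).
Proof.
move=> x0.
have m1 : m%:R + 1 != 0 :> R by rewrite natr1 pnatr_eq0.
have m2 : m%:R + 1 + 1 != 0 :> R by rewrite !natr1 pnatr_eq0.
have := @cvg_sum_baskakov_quadratic R m.+4.+1
  (e + C * (x ^+ 2 - 2 * x * ((s + 1) / m.+2%:R) +
            (s + 1) * (s + 2) / (m.+2%:R * m.+1%:R)))
  (C * ((2 * s + 4) / (m.+2%:R * m.+1%:R) - 2 * x / m.+2%:R))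
  (C / (m.+2%:R * m.+1%:R)) x x0.
have -> : (fun k => baskakov m.+4.+1 k%:Z x *
    (e + C * mean_sq_dev m x (k%:R + s))) =
  (fun k => baskakov m.+4.+1 k%:Z x *
   ((e + C * (x ^+ 2 - 2 * x * ((s + 1) / m.+2%:R) +
              (s + 1) * (s + 2) / (m.+2%:R * m.+1%:R))) +
    C * ((2 * s + 4) / (m.+2%:R * m.+1%:R) - 2 * x / m.+2%:R) * k%:R +
    C / (m.+2%:R * m.+1%:R) * (k%:R * (k%:R - 1)))).
  apply/funext => k; congr (_ * _); rewrite /mean_sq_dev -!natr1.
  by field; rewrite m1 m2.
move=> h; apply: (eq_ind _ (fun l : R => series _ @ \oo --> l) h).
by rewrite -!natr1; field; rewrite m1 m2.
Qed.

(** Each coefficient of the numerator is at most [2 m + 26 = 2 (m + 13)], hence at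
    most [13 (m + 2)]. *)
Lemma mean_sq_dev_series_le (m : nat) (s x : R) : 0 <= x -> 0 <= s <= 1 ->
  ((2 * m%:R + 22) * x ^+ 2 + (2 * m%:R + 18 + 8 * s) * x +
   (s + 1) * (s + 2)) / (m.+2%:R * m.+1%:R) <=
  13 * (x ^+ 2 + x + 1) / m.+1%:R.
Proof.
move=> x0 s01; have m0 : 0 <= m%:R :> R by [].
rewrite invfM mulrA ler_wpM2r ?invr_ge0// ler_pdivrMr ?ltr0n// -!natr1.
have := mulr_ge0 m0 x0; have := mulr_ge0 m0 (sqr_ge0 x).
have := sqr_ge0 x; nra.
Qed.

(** Up to the factor [|a| + |b|], the price of bounding signed weights by
    nonnegative ones, the error is [e] plus a term of order [1/n] that is uniform
    for [x] in a bounded set. *)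
Lemma V1_dist_le (a0 a1 : R^nat) (m : nat) (f : R -> R) (x e C : R) :
  2 * a0 m.+4 - a1 m.+4 = 1 -> 0 <= x -> 0 <= C ->
  measurable_fun (`[0, +oo[%classic : set R) f ->
  (forall t, 0 <= t -> `|f t - f x| <= e + C * (t - x) ^+ 2) ->
  `|V1 a0 a1 m.+4 f x - f x| <=
  (`|acoef a0 a1 x m.+4| + `|bcoef a0 a1 x m.+4|) *
    (e + C * (13 * (x ^+ 2 + x + 1) / m.+1%:R)).
Proof.
move=> a01 x0 C0 mf hf.
set a := acoef _ _ _ _; set b := bcoef _ _ _ _.
pose p k := baskakov m.+4.+1 k%:Z x.
pose q k := baskakov m.+4.+1 (k%:Z - 1) x.
pose I k := \int[mu]_(t in `[0, +oo[) (baskakov m.+4 k%:Z t * f t).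
pose J k := m.+3%:R * I k.
pose W (k : R) := e + C * mean_sq_dev m x k.
pose G k := `|a| * (p k * W k%:R) + `|b| * (q k * W k%:R).
pose E s := e + C * (((2 * m%:R + 22) * x ^+ 2 + (2 * m%:R + 18 + 8 * s) * x +
            (s + 1) * (s + 2)) / (m.+2%:R * m.+1%:R)).
have qS k : q k.+1 = p k by exact: baskakov_predS.
have p0 k : 0 <= p k by exact: baskakov_ge0.
have q0 k : 0 <= q k by exact: baskakov_ge0.
have p1 : series p @ \oo --> (1 : R) by exact: cvg_sum_baskakov.
have q1 : series q @ \oo --> (1 : R) by exact: cvg_series_behead p1.
have pE : series (fun k => p k * W k%:R) @ \oo --> E 0.
  have -> : (fun k => p k * W k%:R) = (fun k => p k * W (k%:R + 0)).
    by apply/funext => k; rewrite addr0.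
  exact: cvg_sum_mean_sq_dev.
have qE : series (fun k => q k * W k%:R) @ \oo --> E 1.
  apply: (@cvg_series_behead _ _ (fun k => p k * W (k%:R + 1))).
  - by rewrite [q 0%N]/= mul0r.
  - by move=> k; rewrite qS natr1.
  - exact: cvg_sum_mean_sq_dev.
pose c := baskakov1 a0 a1 m.+4 ^~ x.
have c1 : series (fun k : nat => c k%:Z) @ \oo --> (1 : R).
  have := cvg_series_add (@cvg_seriesMl _ a _ _ p1) (@cvg_seriesMl _ b _ _ q1).
  by rewrite !mulr1 (_ : a + b = 1)// -a01 /a /b /acoef /bcoef; ring.
have cG (k : nat) : `|c k%:Z * (J k - f x)| <= G k.
  rewrite normrM /G (mulrA `|a|) (mulrA `|b|) -mulrDl ler_pM//.
    rewrite (_ : c k%:Z = a * p k + b * q k)// (le_trans (ler_normD _ _))//.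
    by rewrite (normrM a) (normrM b) (ger0_norm (p0 k)) (ger0_norm (q0 k)).
  exact: Rintegral_baskakov_dist.
have GE := cvg_series_add (@cvg_seriesMl _ `|a| _ _ pE) (@cvg_seriesMl _ `|b| _ _ qE).
have [l cl ly] := cvg_series_dist cG GE c1.
have -> : V1 a0 a1 m.+4 f x = l.
  rewrite /V1 (_ : m.+4%:R - 1 = m.+3%:R); last by rewrite -natr1 addrK.
  have -> : (fun k : nat => baskakov1 a0 a1 m.+4 k%:Z x * I k) =
            (fun k => m.+3%:R^-1 * (c k%:Z * J k)).
    apply/funext => k; rewrite /J (mulrCA (c _)) mulKf ?pnatr_eq0//.
  rewrite (cvg_lim _ (@cvg_seriesMl _ m.+3%:R^-1 _ _ cl))//.
  by rewrite mulVKf ?pnatr_eq0.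
rewrite (le_trans ly)// mulrDl lerD// ler_wpM2l// lerD2l ler_wpM2l//;
  by apply: mean_sq_dev_series_le; rewrite ?lexx ?ler01.
Qed.
End Estimates.

Theorem theorem1 (R : realType) (a0 a1 : R^nat) (f : R -> R)
    (hf : CB f)
    (ha0 : cvgn a0) (ha1 : cvgn a1)
    (ha : forall n : nat, (2 <= n)%N -> 2 * a0 n - a1 n = 1)
    (hpos : V1_positive a0 a1)
    (A : set R) (hA : compact A) (hA0 : A `<=` `[0, +oo[) :
  {uniform A, (fun n : nat => V1 a0 a1 n f) @ \oo --> f}.
Proof.
have mf : measurable_fun (`[0, +oo[%classic : set R) f.
  by apply: subspace_continuous_measurable_fun => //; case: hf.
have [K K1 [aK bK]] : exists2 K : R, 1 <= K &
    (forall n, `|a0 n| <= K) /\ (forall n, `|a1 n| <= K).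
  have [M0 [_ hM0]] := cvg_seq_bounded ha0.
  have [M1 [_ hM1]] := cvg_seq_bounded ha1.
  have := ler_norm M0; have := ler_norm M1.
  have := normr_ge0 M0; have := normr_ge0 M1 => ? ? ? ?.
  exists (`|M0| + `|M1| + 1); first by lra.
  by split=> n; [apply: hM0|apply: hM1] => //; lra.
have [M M0 AM] : exists2 M : R, 0 <= M & forall x, A x -> 0 <= x <= M.
  have [M1 [_ hM1]] := compact_bounded hA.
  exists (`|M1| + 1) => [|x Ax]; first by rewrite addr_ge0.
  have := hA0 _ Ax; rewrite /= in_itv/= andbT => x0; rewrite x0 /=.
  rewrite -(ger0_norm x0); apply: (hM1 (`|M1| + 1)) => //.
  by rewrite (le_lt_trans (ler_norm _))// ltrDl.
(* [Q] bounds [|a(x,n)| + |b(x,n)| <= 2 K + K (1 + 2 M)] on [A]. *)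
pose Q := K * (3 + 2 * M); have Q0 : 0 < Q by rewrite mulr_gt0//; lra.
move=> P /uniform_nbhs[E [+ EP]]; rewrite -entourage_ballE => -[/= eps eps0 epsE].
(* Half of [eps] is spent on [e], which gets multiplied by [Q]. *)
have e0 : 0 < eps / (2 * Q) by rewrite divr_gt0// mulr_gt0.
have [C C0 hC] := le_quadratic_modulus hf hA hA0 e0.
pose B := Q * C * (13 * (M ^+ 2 + M + 1)).
have B0 : 0 <= B.
  by rewrite /B; apply: mulr_ge0; [rewrite mulr_ge0// ltW|nra].
(* [B + 1] rather than [B], which may be 0. *)
have d0 : 0 < eps / 2 / (B + 1) by rewrite !divr_gt0// ltr_wpDl.
have [N _ hN] := near_infty_natSinv_lt (PosNum d0).
exists (N + 4)%N => //= n Nn.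
have [m nm Nm] : exists2 m, n = m.+4 & (N <= m)%N.
  by move: Nn; rewrite /mkset/=; exists (n - 4)%N; lia.
rewrite {n Nn}nm; apply: EP => x Ax; apply: epsE; rewrite /ball/= distrC.
have /andP[x0 xM] := AM _ Ax.
apply: (le_lt_trans (V1_dist_le (ha m.+4 isT) x0 C0 mf (fun t => hC x t Ax))).
have ab : `|acoef a0 a1 x m.+4| + `|bcoef a0 a1 x m.+4| <= Q.
  rewrite /acoef /bcoef.
  have := aK m.+4; have := bK m.+4 => bm am.
  have vx : `|a1 m.+4| * x <= K * M by rewrite ler_pM.
  rewrite (le_trans (lerD (ler_normD _ _) (ler_normB _ _)))// !normrM.
  rewrite (ger0_norm x0) (ger0_norm (addr_ge0 ler01 x0)) /Q.
  lra.
have Bm : B / m.+1%:R < eps / 2.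
  rewrite (@le_lt_trans _ _ ((B + 1) / m.+1%:R))//; first by rewrite ler_wpM2r// lerDl.
  by have := hN m Nm; rewrite /= ltr_pdivlMr ?ltr_wpDl// mulrC.
apply: (@le_lt_trans _ _ (Q * (eps / (2 * Q) + C * (13 * (M ^+ 2 + M + 1) / m.+1%:R)))).
  apply: ler_pM => //.
    have Sx : 0 <= 13 * (x ^+ 2 + x + 1) by have := sqr_ge0 x; lra.
    by rewrite addr_ge0 ?(ltW e0)// mulr_ge0// divr_ge0.
  rewrite lerD2l ler_wpM2l// ler_wpM2r ?invr_ge0// ler_wpM2l//.
  by rewrite lerD2r lerD// lerXn2r ?nnegrE.
rewrite (_ : _ * _ = eps / 2 + B / m.+1%:R).
  by rewrite [ltRHS]splitr ltrD2l.
rewrite /B; have := lt0r_neq0 Q0; move: (pnatr_eq0 R m.+1); clearbody Q.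
by move: m.+1%:R => v v0 Q1; field; rewrite Q1 v0.
Qed.
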